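(* For each $n\ge1$ let $\phi_n:\{-1,+1\}^n\to\{-1,+1\}$ be a function, and let $\eta_n=\phi_n(\xi_1,\ldots,\xi_n)$. Then the sequences $(\eta_n)_{n\ge1}$ and $(\xi_n)_{n\ge1}$ have the same law if and only if for every $n\ge1$ the function $\phi_n$ is of the form $$\phi_n(u_1,\ldots,u_n)=\psi_{n-1}(u_1,\ldots,u_{n-1})\,u_n\qquad\text{for all }(u_1,\ldots,u_n)\in\{-1,+1\}^n,$$ where $\psi_{n-1}$ is some function of $(u_1,\ldots,u_{n-1})\in\{-1,+1\}^{n-1}$ taking values in $\{-1,+1\}$, and $\psi_0\in\{-1,+1\}$ is a constant.
   Context: $\xi_1,\xi_2,\ldots$ are independent and identically distributed random variables with $\mathbb{P}(\xi_1=-1)=\mathbb{P}(\xi_1=+1)=\frac12$. *)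

(* Defs.v *)
From HB Require Import structures.
From mathcomp Require Import all_boot all_order all_algebra finmap.
From mathcomp Require Import all_classical all_reals all_analysis.

Set Implicit Arguments.
Unset Strict Implicit.
Unset Printing Implicit Defensive.

Import Order.TTheory GRing.Theory Num.Theory.

Local Open Scope classical_set_scope.
Local Open Scope ring_scope.

(* The set {-1, +1} of integers, with its power set as sigma-algebra. *)
Definition pm1 : Type := seq_sub [:: -1; 1 : int].

Definition int_of_pm1 (s : pm1) : int := ssval s.

HB.instance Definition _ := Finite.on pm1.
HB.instance Definition _ :=
  isPointed.Build pm1 (SeqSub (mem_last (-1 : int) [:: 1]) : pm1).
HB.instance Definition _ := @isMeasurable.Build default_measure_display
  pm1 (@discrete_measurable pm1) (@discrete_measurable0 pm1)
  (@discrete_measurableC pm1) (@discrete_measurableU pm1).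

Section sequences_of_random_variables.
Context d d' (T : measurableType d) (S : measurableType d') (R : realType).
Variable P : probability T R.

Definition mutually_independent (X : nat -> {RV P >-> S}) : Prop :=
  forall (J : {fset nat}) (B : nat -> set S), (forall i, measurable (B i)) ->
    P (\bigcap_(i in [set` J]) (X i @^-1` B i)) =
    (\prod_(i <- J) P (X i @^-1` B i))%E.

Definition identically_distributed (X : nat -> {RV P >-> S}) : Prop :=
  forall (i j : nat) (B : set S), measurable B ->
    distribution P (X i) B = distribution P (X j) B.

Definition iid (X : nat -> {RV P >-> S}) : Prop :=
  mutually_independent X /\ identically_distributed X.

(* Sequences in S with the product sigma-algebra, which is generated by the
   coordinate projections. *)
Definition sequence_space :=
  g_sigma_algebraType (\bigcup_(i : nat)
    preimage_set_system [set: nat -> S] (fun u => u i) (@measurable _ S)).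

Definition path_of (X : nat -> T -> S) : T -> sequence_space :=
  fun t i => X i t.

(* The laws are compared as set functions, so that no measurability proof for
   path_of is needed in order to state their equality. *)
Definition same_law (X Y : nat -> T -> S) : Prop :=
  forall A : set sequence_space, measurable A ->
    pushforward P (path_of X) A = pushforward P (path_of Y) A.

End sequences_of_random_variables.

(* Main.v *)
Require Import Defs.
From HB Require Import structures.
From mathcomp Require Import all_boot all_order all_algebra.
From mathcomp Require Import all_classical all_reals all_analysis.
From mathcomp Require Import finmap.

Set Implicit Arguments.
Unset Strict Implicit.
Unset Printing Implicit Defensive.

Import Order.TTheory GRing.Theory Num.Theory.

Local Open Scope classical_set_scope.
Local Open Scope ring_scope.

(** For each n the functions phi_0, ..., phi_(n-1) induce a map Phi_n of
    {-1, +1}^n to itself ([transform]) that carries the first n values of xi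
    to the first n values of eta ([initial_transform]).  Three facts give the
    result.

    - A law on sequences of signs is determined by the laws of its initial
      segments ([same_lawP]): the events that depend on finitely many
      coordinates form a pi-system generating the product sigma-algebra, and
      each is a finite disjoint union of events fixing an initial segment.
    - The first n values of xi are uniform on {-1, +1}^n
      ([probability_initial_iid]).  Their image under Phi_n is again uniform
      exactly when Phi_n is a bijection: a uniform image charges every point,
      so Phi_n is onto; conversely a bijection preserves the uniform law.  On a
      finite set, being bijective is the same as being injective.
    - Phi_(n+1) u consists of Phi_n (u without its last entry) followed by
      phi_n u.  Hence all the Phi_n are injective exactly when each phi_n, with
      all entries but the last held fixed, is injective in the last one
      ([transform_inj]).  The only injections of {-1, +1} into itself are the
      multiplications by a sign, which is the announced form with psi_n as that
      sign ([sign_formP]). *)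

(** * Initial segments *)

Definition initial (T : Type) n (x : nat -> T) : n.-tuple T :=
  [tuple x i | i < n].
Arguments initial {T} n x.

Definition front (T : Type) n (u : n.+1.-tuple T) : n.-tuple T :=
  [tuple tnth u (widen_ord (leqnSn n) i) | i < n].

Lemma rcons_front (T : Type) n (u : n.+1.-tuple T) :
  u = rcons_tuple (front u) (tnth u ord_max).
Proof.
apply: eq_from_tnth => i.
rewrite [RHS](tnth_nth (tnth u ord_max)) nth_rcons size_tuple.
case: ltnP => [lt_in|le_ni].
  rewrite -[X in nth _ _ X]/(val (Ordinal lt_in)) -tnth_nth tnth_mktuple.
  by congr (tnth u _); apply: val_inj.
have -> : i = ord_max by apply/val_inj/eqP; rewrite eqn_leq le_ni -ltnS ltn_ord.
by rewrite eqxx.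
Qed.

Lemma front_rcons (T : Type) n (v : n.-tuple T) a :
  front (rcons_tuple v a) = v.
Proof.
apply: eq_from_tnth => i; rewrite tnth_mktuple !(tnth_nth a) /= nth_rcons.
by rewrite size_tuple ltn_ord.
Qed.

Lemma last_rcons_tuple (T : Type) n (v : n.-tuple T) a :
  tnth (rcons_tuple v a) ord_max = a.
Proof. by rewrite (tnth_nth a) /= nth_rcons size_tuple ltnn eqxx. Qed.

Lemma front_initial (T : Type) n (x : nat -> T) :
  front (initial n.+1 x) = initial n x.
Proof. by apply: eq_from_tnth => i; rewrite !tnth_mktuple. Qed.

Lemma initialS (T : Type) n (x : nat -> T) :
  initial n.+1 x = rcons_tuple (initial n x) (x n).
Proof.
by rewrite [LHS]rcons_front front_initial tnth_mktuple.
Qed.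

(** * Adapted transformations of finite words *)

Section Adapted.
Variables (S : Type) (phi : forall n, n.+1.-tuple S -> S).

(** The map Phi_n: entry k of the output is phi_k of the first k+1 entries.
    The recursion from the right makes the equivalence [transform_inj] a plain
    induction. *)
Fixpoint transform n : n.-tuple S -> n.-tuple S :=
  if n is m.+1 then
    fun u => rcons_tuple (transform (front u)) (phi u)
  else id.

Lemma initial_transform n (x : nat -> S) :
  initial n (fun k => phi (initial k.+1 x)) = transform (initial n x).
Proof.
elim: n => [|n IHn]; first by rewrite (tuple0 (initial _ _)) [RHS]tuple0.
by rewrite initialS IHn /= front_initial.
Qed.

(** Two words of length n+1 have the same image iff their fronts have the same
    image and phi_n agrees on them.  If Phi_n is injective the fronts are then
    equal, so that only injectivity of phi_n in its last argument is left. *)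
Lemma transform_inj : (forall n, injective (@transform n)) <->
  (forall n (u w : n.+1.-tuple S), front u = front w -> phi u = phi w -> u = w).
Proof.
split=> [inj n u w fuw puw|phi_inj].
  by apply: (inj n.+1); rewrite /= fuw puw.
elim=> [|n IHn] u w; first by rewrite (tuple0 u) (tuple0 w).
move=> /(congr1 val) /= /rcons_inj [] /val_inj /IHn fuw puw.
exact: phi_inj.
Qed.

End Adapted.

(** * Signs *)

Lemma int_pm1P (s : pm1) : int_of_pm1 s = -1 \/ int_of_pm1 s = 1.
Proof.
by have := ssvalP s; rewrite !inE => /orP[] /eqP; [left|right].
Qed.

Definition plus1 : pm1 := SeqSub (mem_last (-1 : int) [:: 1]).

Lemma int_of_pm1_inj : injective int_of_pm1.
Proof. exact: val_inj. Qed.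

(** For a fixed front v, the sign psi v can only be the value of phi at v
    followed by +1; injectivity forces the opposite value at v followed by
    -1. *)
Lemma sign_formP n (phi : n.+1.-tuple pm1 -> pm1) :
  (exists psi : n.-tuple pm1 -> pm1, forall u : n.+1.-tuple pm1,
     int_of_pm1 (phi u) =
       int_of_pm1 (psi (front u)) * int_of_pm1 (tnth u ord_max)) <->
  (forall u w, front u = front w -> phi u = phi w -> u = w).
Proof.
split=> [[psi phiE] u w fuw puw|inj].
  rewrite (rcons_front u) (rcons_front w) fuw.
  have /= := phiE u; rewrite puw phiE fuw => /mulfI eq_last.
  rewrite (int_of_pm1_inj (eq_last _))//.
  by case: (int_pm1P (psi (front w))) => ->.
exists (fun v => phi (rcons_tuple v plus1)) => u.
set w := rcons_tuple _ plus1.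
have fuw : front u = front w by rewrite front_rcons.
case: (int_pm1P (tnth u ord_max)) => last_u; rewrite last_u ?mulr1.
  (* u and w differ in their last entry, so phi u and phi w are distinct,
     hence opposite, signs. *)
  have : phi u != phi w.
    apply/eqP => /(inj _ _ fuw) uw.
    by move: last_u; rewrite uw last_rcons_tuple.
  rewrite -(inj_eq int_of_pm1_inj).
  by case: (int_pm1P (phi u)) (int_pm1P (phi w)) => -> [] ->.
suff -> : w = u by [].
rewrite (rcons_front u) /w; congr rcons_tuple.
exact: int_of_pm1_inj.
Qed.

(** * Laws of sequences of signs *)

(** Every set of words of length n is allowed here because it is finite: the
    event is the finite union over D of the events fixing the word. *)
Lemma measurable_initial d (T : measurableType d) (X : nat -> T -> pm1)
    n (D : set (n.-tuple pm1)) :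
  (forall i, measurable_fun setT (X i)) ->
  measurable [set t | D (initial n (X ^~ t))].
Proof.
move=> mX.
have -> : [set t | D (initial n (X ^~ t))] =
    \bigcup_(v in D) [set t | initial n (X ^~ t) = v].
  by apply/seteqP; split=> [t Dt|t [v Dv /= ->]//]; exists (initial n (X ^~ t)).
apply: fin_bigcup_measurable => [|v _]; first exact: finite_finset.
elim: n v {D} => [|n IHn] v.
  rewrite (_ : mkset _ = setT)//; apply/seteqP; split=> // t _ /=.
  by rewrite (tuple0 v) tuple0.
have -> : [set t | initial n.+1 (X ^~ t) = v] =
    [set t | initial n (X ^~ t) = front v] `&`
    (X n @^-1` [set tnth v ord_max]).
  apply/seteqP; split=> t /=; rewrite initialS.
    by move=> <-; rewrite front_rcons last_rcons_tuple.
  by move=> [-> ->]; rewrite -rcons_front.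
apply: measurableI; first exact: IHn.
by rewrite -[X in measurable X]setTI; exact: mX.
Qed.

(** Stating that A does not see beyond the first n coordinates, rather than
    that A comes from some set of words of length n, allows n to be enlarged
    freely ([initial_le]); stability under intersection is then immediate. *)
Definition cylinder_event (A : set (nat -> pm1)) :=
  exists n, forall x y, initial n x = initial n y -> A x -> A y.

Lemma initial_le (n m : nat) (x y : nat -> pm1) : (n <= m)%N ->
  initial m x = initial m y -> initial n x = initial n y.
Proof.
move=> le_nm /(congr1 (fun u => @tnth _ _ u)) xy.
apply: eq_from_tnth => i; rewrite !tnth_mktuple.
by have /(congr1 (@^~ (widen_ord le_nm i))) := xy; rewrite !tnth_mktuple.
Qed.

Lemma cylinder_eventI : setI_closed cylinder_event.
Proof.
move=> A B [n An] [m Bm]; exists (maxn n m) => x y xy [Ax Bx].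
split; [apply: An Ax|apply: Bm Bx]; apply: initial_le xy.
  exact: leq_maxl.
exact: leq_maxr.
Qed.

Lemma cylinder_eventE A : cylinder_event A ->
  exists n, exists D : set (n.-tuple pm1), A = [set x | D (initial n x)].
Proof.
move=> [n An]; exists n, (initial n @` A); apply/seteqP; split=> x /=.
  by move=> Ax; exists x.
by move=> [y Ay yx]; exact: An yx Ay.
Qed.

Lemma measurable_initial_path n (D : set (n.-tuple pm1)) :
  measurable ([set x | D (initial n x)] : set (sequence_space pm1)).
Proof.
apply: (@measurable_initial _ (sequence_space pm1) (fun i x => x i) n D)
  => i _ B mB.
rewrite setTI; apply: sub_sigma_algebra; exists i => //.
by exists B; rewrite ?setTI.
Qed.

(** A coordinate event depends on finitely many coordinates; conversely every
    cylinder event is measurable, there being finitely many words of each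
    length. *)
Lemma measurable_sequence_space :
  @measurable _ (sequence_space pm1) = <<s cylinder_event >>.
Proof.
apply/seteqP; split.
  apply: smallest_sub; first exact: smallest_sigma_algebra.
  move=> _ [i _ [B _ <-]]; apply: sub_sigma_algebra; exists i.+1 => x y xy.
  rewrite !setTI /=; have /(congr1 (fun u => tnth u ord_max)) := xy.
  by rewrite !tnth_mktuple /= => ->.
apply: smallest_sub; first exact: sigma_algebra_measurable.
by move=> A /cylinder_eventE [n [D ->]]; exact: measurable_initial_path.
Qed.

Section Laws.
Context d (T : measurableType d) (R : realType) (P : probability T R).

Lemma path_of_measurable (X : nat -> T -> pm1) :
  (forall i, measurable_fun setT (X i)) -> measurable_fun setT (path_of X).
Proof.
move=> mX; apply: (@measurability _ _ _ (sequence_space pm1) setT (path_of X)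
  (\bigcup_(i : nat)
    preimage_set_system [set: nat -> pm1] (@^~ i) (@measurable _ pm1))) => //.
move=> _ [_ [i _ [B mB <-]] <-].
by rewrite !setTI -[X in measurable X]setTI; exact: mX.
Qed.

Lemma probability_initial (X : nat -> T -> pm1) n (D : set (n.-tuple pm1)) :
  (forall i, measurable_fun setT (X i)) ->
  P [set t | D (initial n (X ^~ t))] =
  (\sum_(v \in D) P [set t | initial n (X ^~ t) = v])%E.
Proof.
move=> mX; rewrite -measure_fin_bigcup.
- congr (P _); apply/seteqP; split=> [t Dt|t [v Dv /= ->]//].
  by exists (initial n (X ^~ t)).
- exact: finite_finset.
- by move=> u v _ _ [t [/= <- <-]].
- by move=> v _; exact: (measurable_initial [set v]).
Qed.

(** Two probability measures that agree on a generating pi-system are equal. *)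
Lemma same_lawP (X Y : nat -> T -> pm1) :
  (forall i, measurable_fun setT (X i)) ->
  (forall i, measurable_fun setT (Y i)) ->
  same_law P X Y <->
  (forall n v, P [set t | initial n (X ^~ t) = v] =
               P [set t | initial n (Y ^~ t) = v]).
Proof.
move=> mX mY; split=> [XY n v|XY].
  apply: (XY [set x | initial n x = v]).
  exact: (measurable_initial_path [set v]).
(* A pushforward is a measure only for a measurable map, so the measure
   structure takes the measurability proof as an explicit argument. *)
pose law Z (mZ : forall i, measurable_fun setT (Z i)) :
    {measure set (sequence_space pm1) -> \bar R} :=
  measure_function_pushforward__canonical__measure_function_Measure P
    (path_of_measurable mZ).
move=> A mA.
apply: (@measure_unique _ R (sequence_space pm1) cylinder_event (fun=> setT)
  measurable_sequence_space cylinder_eventI _ _ (law X mX) (law Y mY)) mA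
  => [_|||_].
- by exists 0%N.
- exact: bigcup_const.
- move=> C /cylinder_eventE [n [D ->]]; rewrite /law /= /pushforward.
  by rewrite !probability_initial//; apply: eq_fsbigr => v _; exact: XY.
- by rewrite /law /= /pushforward preimage_setT probability_setT ltry.
Qed.

(** Identical distribution carries the hypothesis at index 0 to every index,
    so each of the n independent constraints contributes the same factor p,
    whatever the word v is. *)
Lemma probability_initial_iid (xi : nat -> {RV P >-> pm1}) (p : R)
    n (v : n.-tuple pm1) :
  iid xi -> (forall s, P (xi 0%N @^-1` [set s]) = p%:E) ->
  P [set t | initial n (fun i => xi i t) = v] = (p ^+ n)%:E.
Proof.
move=> [indep ident] uniform.
pose J := seq_fset tt (iota 0 n).
have -> : [set t | initial n (fun i => xi i t) = v] =
    \bigcap_(i in [set` J]) (xi i @^-1` [set nth plus1 v i]).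
  apply/seteqP; split=> t /=.
    move=> <- i /=; rewrite seq_fsetE mem_iota add0n => /= lt_in.
    have := tnth_nth plus1 (initial n (fun i => xi i t)) (Ordinal lt_in).
    by rewrite tnth_mktuple.
  move=> xiv; apply: eq_from_tnth => i; rewrite tnth_mktuple (tnth_nth plus1).
  by apply: xiv; rewrite /= seq_fsetE mem_iota add0n ltn_ord.
rewrite indep//; under eq_bigr => i _.
  have -> : P (xi i @^-1` [set nth plus1 v i]) = p%:E.
    by rewrite -(uniform (nth plus1 v i)); exact: ident.
  over.
rewrite prodEFin big_const_seq count_predT -Monoid.iteropE.
by rewrite size_seq_fset undup_id ?iota_uniq// size_iota.
Qed.

End Laws.

(* Indices are shifted by one: xi n, eta n and phi n are the paper's
   xi_{n+1}, eta_{n+1} and phi_{n+1}. *)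
Theorem proposition1 (d : measure_display) (T : measurableType d)
    (R : realType) (P : probability T R) (xi : nat -> {RV P >-> pm1})
    (xi_iid : iid xi)
    (xi_N1 : P [set t | int_of_pm1 (xi 0%N t) = -1] = (1 / 2 : R)%:E)
    (xi_1 : P [set t | int_of_pm1 (xi 0%N t) = 1] = (1 / 2 : R)%:E)
    (phi : forall n : nat, n.+1.-tuple pm1 -> pm1) :
  let eta (n : nat) (t : T) : pm1 := phi n [tuple xi i t | i < n.+1] in
  same_law P eta xi <->
  (forall n : nat, exists psi : n.-tuple pm1 -> pm1,
     forall u : n.+1.-tuple pm1,
       int_of_pm1 (phi n u) =
       int_of_pm1 (psi [tuple tnth u (widen_ord (leqnSn n) i) | i < n])
       * int_of_pm1 (tnth u ord_max)).
Proof.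
move=> eta.
have m_xi i : measurable_fun setT (xi i) by exact: measurable_funPT.
have m_eta n : measurable_fun setT (eta n).
  move=> _ B _; rewrite setTI.
  exact: (@measurable_initial _ _ xi n.+1 [set u | B (phi n u)]).
have uniform s : P (xi 0%N @^-1` [set s]) = (1 / 2 : R)%:E.
  case: (int_pm1P s) => s_val; [rewrite -xi_N1|rewrite -xi_1];
    congr (P _); apply/seteqP; split=> t /=; rewrite -s_val.
  - by move=> ->.
  - exact: int_of_pm1_inj.
  - by move=> ->.
  - exact: int_of_pm1_inj.
have law_xi n v :
    P [set t | initial n (fun i => xi i t) = v] = ((1 / 2) ^+ n)%:E.
  exact: probability_initial_iid.
have initial_eta n t :
    initial n (eta ^~ t) = transform phi (initial n (fun i => xi i t)).
  exact: initial_transform.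
rewrite (same_lawP P m_eta m_xi).
transitivity (forall n, injective (@transform _ phi n)).
  split=> [same n|inj n v].
    (* Every word v has positive probability of being an initial segment of
       xi, hence of eta; so some word is mapped to v. *)
    have surj (v : n.-tuple pm1) : exists u, transform phi u = v.
      have : P [set t | initial n (eta ^~ t) = v] != 0.
        by rewrite same law_xi eqe expf_neq0// mul1r invr_eq0.
      have [->|/set0P[t <-] _] :=
        eqVneq [set t | initial n (eta ^~ t) = v] set0.
        by rewrite measure0 eqxx.
      by exists (initial n (fun i => xi i t)); rewrite initial_eta.
    (* A section of Phi_n is injective, hence bijective by finiteness, and
       Phi_n is then its two-sided inverse. *)
    have [g gK] := choice surj.
    have /injF_bij g_bij : injective g by exact: can_inj gK.
    exact: bij_inj (bij_can_bij g_bij gK).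
  have [g transformK gK] := injF_bij (inj n).
  rewrite (_ : [set t | initial n (eta ^~ t) = v] =
    [set t | initial n (fun i => xi i t) = g v]) ?law_xi//.
  apply/seteqP; split=> t /=; rewrite initial_eta.
    by move=> <-; rewrite transformK.
  by move=> ->; rewrite gK.
rewrite transform_inj; split=> H n; have /sign_formP := H n; exact.
Qed.
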